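(* For all $N$-element point sets $\mathcal{P}=\{x_0,\dots,x_{N-1}\}\subset[0,1]$ we have $$\mathbb P(|\widetilde D_{\mathcal P}|<\alpha)\leq\mathbb P(|\widetilde D_{\Gamma_N}|<\alpha),\qquad \alpha>0,$$ and equality for all $\alpha>0$ holds if and only if $\mathcal P=\Gamma_N^\delta$ for some $\delta\in[0,1/N)$.
   Context: Let $N$ be a natural number. The centered regular grid is $\Gamma_N=\left\{\frac{2n+1}{2N}: n=0,\dots,N-1\right\}$, and for $\delta\in[0,1/N)$ the translated regular grid is $\Gamma_N^\delta=\left\{\frac{n}{N}+\delta: n=0,\dots,N-1\right\}$, so that $\Gamma_N^{1/(2N)}=\Gamma_N$. For an $N$-element point set $\mathcal P=\{x_0,\ldots,x_{N-1}\}$ in the unit interval $[0,1]$ (arranged increasingly), let $D_{\mathcal P}(t)=\sum_{n=0}^{N-1}\mathbf 1_{[0,t)}(x_n)-Nt$ for $t\in[0,1]$, where $\mathbf 1_A$ is the indicator function of the set $A$. The two-parameter discrepancy function is $\widetilde D_{\mathcal P}(t_1,t_2)=\sum_{n=0}^{N-1}\mathbf 1_{[t_1,t_2)}(x_n)-N(t_2-t_1)$ for $0\leq t_1\leq t_2\leq 1$; it equals $D_{\mathcal P}(t_2)-D_{\mathcal P}(t_1)$ there and is extended to all of $[0,1]^2$ by the formula $\widetilde D_{\mathcal P}(t_1,t_2)=D_{\mathcal P}(t_2)-D_{\mathcal P}(t_1)$. The distribution is $\mathbb P(|\widetilde D_{\mathcal P}|<\alpha):=|\{(t_1,t_2)\in[0,1]^2:|\widetilde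 D_{\mathcal P}(t_1,t_2)|<\alpha\}|$, where $|\cdot|$ of a set is Lebesgue measure (this equals the normalized measure of the corresponding subset of $\{0\leq t_1\leq t_2\leq 1\}$).
   Formalization: The equality clause fails as stated for P={1/N,2/N,…,1}: it attains equality for all α>0 but is not Γ_N^δ with δ in [0,1/N). The theorem proved adds this set (the grid with δ=1/N) as a further equality case, and takes N≥1. *)

(* Defs.v *)
From HB Require Import structures.
From mathcomp Require Import all_boot all_order all_algebra finmap.
From mathcomp Require Import all_classical all_reals all_analysis.
From mathcomp Require Import ring.

Set Implicit Arguments.
Unset Strict Implicit.
Unset Printing Implicit Defensive.

Import Order.TTheory GRing.Theory Num.Theory.

Local Open Scope classical_set_scope.
Local Open Scope fset_scope.
Local Open Scope ring_scope.

(* A finite point set is an [{fset R}]: its points are distinct and their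
   enumeration carries no information, so sums over x_0, ..., x_(N-1) become
   sums over the elements of [P], with N = #|` P|. *)

Definition discr (R : realType) (P : {fset R}) (t : R) : R :=
  (\sum_(x <- P) \1_(`[0%R, t[%classic) x) - #|` P|%:R * t.

(* The extension to the whole square is the definition; [discr2_countE] gives
   the counting formula on the triangle t1 <= t2. *)
Definition discr2 (R : realType) (P : {fset R}) (t1 t2 : R) : R :=
  discr P t2 - discr P t1.

Definition discr2_distr (R : realType) (P : {fset R}) (a : R) : \bar R :=
  (@lebesgue_measure R \x @lebesgue_measure R)%E
    [set t : R * R | [/\ 0 <= t.1 <= 1, 0 <= t.2 <= 1
                       & `|discr2 P t.1 t.2| < a]].

Definition centered_grid (R : realType) (N : nat) : {fset R} :=
  [fset (2 * n + 1)%N%:R / (2 * N)%N%:R | n in iota 0 N].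

(* Used for 0 <= d < 1/N, and for the boundary value d = 1/N, which gives
   {1/N, ..., 1}: as [discr] counts in half-open intervals [0, t[, the point 1
   is never counted, so discr of this set equals discr (shifted_grid N 0) - 1
   on ]0, 1], and discr2_distr is the same for both sets. *)
Definition shifted_grid (R : realType) (N : nat) (d : R) : {fset R} :=
  [fset n%:R / N%:R + d | n in iota 0 N].

Lemma shifted_grid_centered (R : realType) (N : nat) :
  shifted_grid N (2 * N)%N%:R^-1 = centered_grid R N.
Proof.
have E (n : nat) : n%:R / N%:R + (2 * N)%N%:R^-1
    = (2 * n + 1)%N%:R / (2 * N)%N%:R :> R.
  by rewrite natrD mulrDl mul1r !natrM -mulf_div divff ?mul1r// pnatr_eq0.
by apply/fsetP => x; apply/imfsetP/imfsetP => -[n nN ->]; exists n => //;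
  rewrite E.
Qed.

Lemma card_shifted_grid (R : realType) (N : nat) (d : R) :
  #|` shifted_grid N d| = N.
Proof.
have [->|N0] := eqVneq N 0%N.
  apply/eqP; rewrite cardfs_eq0; apply/eqP/fsetP => x.
  by rewrite inE; apply/negP => /imfsetP[].
rewrite card_imfset/=.
  by rewrite undup_id ?iota_uniq// size_iota.
move=> m n /addIr/mulIf; rewrite invr_eq0 pnatr_eq0 => /(_ N0)/eqP.
by rewrite eqr_nat => /eqP.
Qed.

Lemma discr2_countE (R : realType) (P : {fset R}) (t1 t2 : R) :
  0 <= t1 -> t1 <= t2 ->
  discr2 P t1 t2 =
  (\sum_(x <- P) \1_(`[t1, t2[%classic) x) - #|` P|%:R * (t2 - t1).
Proof.
move=> t10 t12; rewrite /discr2 /discr mulrBr.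
suff -> : \sum_(x <- P) \1_(`[0, t2[%classic) x
   = \sum_(x <- P) \1_(`[0, t1[%classic) x
     + \sum_(x <- P) \1_(`[t1, t2[%classic) x :> R.
  by ring.
rewrite -big_split/=; apply: eq_bigr => x _.
rewrite !indicE !mem_setE !in_itv/=.
case: (ltP x t1) => xt1.
  by rewrite (lt_le_trans xt1 t12)/= addr0.
by rewrite (le_trans t10 xt1)/= add0r.
Qed.

(* Main.v *)
Require Import Defs.
From mathcomp Require Import all_boot all_order all_algebra finmap.
From mathcomp Require Import all_classical all_reals all_analysis.
From mathcomp Require Import measurable_realfun zify ring lra.

(** Let [D] be the discrepancy function of [P], and regard it as a random
    variable on the unit interval with the uniform law; let [F] be its
    distribution function.  The claim concerns the law of [|D t - D s|] for
    independent [s] and [t].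

    Since [D t] is an integer minus [N * t], the values of [D] are uniform
    modulo 1, whatever [P] is; in particular an interval of length at most 1 is
    hit with at most its length as probability, that is, [F] is 1-Lipschitz
    ([value_cdf_discr_lipschitz]).  Now [F] composed with [D] is uniform on
    the unit interval ([value_cdf_uniform]), and
    [|F (D t) - F (D s)| <= |D t - D s|].  So the gaps between values of [D]
    are stochastically at least as large as the gaps between two independent
    uniform variables, a law which does not depend on [P]
    ([rank_set_le_gap_set], [rank_set_discr_eq]).

    If [D] oscillates by at most 1, then [F] is an isometry on the range of [D]
    and the two laws agree ([rank_set_eq_gap_set]).  This is the case for every
    shifted grid ([discr_shifted_grid]), which yields the inequality as well as
    the sufficiency of the condition for equality.

    Conversely, equality at [a = 1] makes [|D t - D s| < 1] almost sure, so the
    oscillation of [D] is at most 1 ([discr_jump_le1]).  But [D] jumps by 1 at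
    each point of [P], hence it has one and the same value, its infimum, at
    all these points, and as it falls with slope [-N] between them they form a
    shifted grid ([fset_eq_shifted_grid]). *)

Set Implicit Arguments.
Unset Strict Implicit.
Unset Printing Implicit Defensive.

Import Order.TTheory GRing.Theory Num.Theory.

Local Open Scope classical_set_scope.
Local Open Scope ring_scope.

(** * Slicing planar sets *)

Section sections.
Variable R : realType.
Local Notation lam := (@lebesgue_measure R).
Implicit Types A B : set (R * R).
Local Open Scope ereal_scope.

(** The product measure is defined by integrating over the first coordinate;
    slicing along either coordinate is what turns one planar set into two
    different one-dimensional computations below. *)
Lemma product_measure_ysection A : measurable A ->
  (lam \x lam) A = \int[lam]_y lam (ysection A y).
Proof.
move=> mA; rewrite (product_measure_unique (m' := lam \x^ lam))//.
by move=> B C mB mC; exact: product_measure2E.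
Qed.

Lemma le_product_measure_ysection A B : measurable A -> measurable B ->
  (forall y, lam (ysection B y) <= lam (ysection A y)) ->
  (lam \x lam) B <= (lam \x lam) A.
Proof.
move=> mA mB BA; rewrite !product_measure_ysection//.
by apply: ge0_le_integral => //=; exact: measurable_fun_ysection.
Qed.

Lemma eq_product_measure_ysection A B : measurable A -> measurable B ->
  (forall y, lam (ysection B y) = lam (ysection A y)) ->
  (lam \x lam) B = (lam \x lam) A.
Proof.
by move=> mA mB BA; rewrite !product_measure_ysection//; exact: eq_integral.
Qed.

Lemma eq_product_measure_xsection A B :
  (forall x, lam (xsection B x) = lam (xsection A x)) ->
  (lam \x lam) B = (lam \x lam) A.
Proof. by move=> BA; apply: eq_integral => x _; exact: BA. Qed.

End sections.

(** * Gaps between values and gaps between ranks *)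

Section uniform_rank.
Variables (R : realType) (f : R -> R).
Local Notation lam := (@lebesgue_measure R).

Lemma lebesgue_measure01 : lam `[0%R, 1%R] = 1%E.
Proof. by rewrite lebesgue_measure_itv/= lte_fin ltr01 oppr0 adde0. Qed.

Lemma measurable_unit_square :
  measurable [set p : R * R | 0 <= p.1 <= 1 /\ 0 <= p.2 <= 1].
Proof.
rewrite (_ : [set _ | _] = `[0, 1] `*` `[0, 1]).
  by apply: measurableX; exact: measurable_itv.
by apply/seteqP; split => p /=; rewrite !in_itv.
Qed.

Lemma lebesgue_measure_unit_square :
  (lam \x lam)%E [set p : R * R | 0 <= p.1 <= 1 /\ 0 <= p.2 <= 1] = 1%E.
Proof.
rewrite (_ : [set _ | _] = `[0, 1] `*` `[0, 1]); last first.
  by apply/seteqP; split => p /=; rewrite !in_itv.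
by rewrite product_measure1E//= lebesgue_measure01 mule1.
Qed.

Definition sublevel (x : R) : set R := [set s | 0 <= s <= 1 /\ f s <= x].

(** The distribution function of [f], seen as a random variable on the unit
    interval with the uniform law. *)
Definition value_cdf (x : R) : R := fine (lam (sublevel x)).

(** Up to exchanging the coordinates, this is one of the two halves, equal in
    measure, of the event that two independent values of [f] differ by at
    least [a]. *)
Definition gap_set (a : R) : set (R * R) :=
  [set p | (0 <= p.1 <= 1 /\ 0 <= p.2 <= 1) /\ f p.1 <= f p.2 - a].

(** A planar representation of the positive part of
    [value_cdf (f t) - a]: its slice at [t] is an interval of that length. *)
Definition rank_set (a : R) : set (R * R) :=
  [set p | (0 <= p.1 <= 1 /\ 0 <= p.2 <= 1) /\ p.1 + a < value_cdf (f p.2)].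

Hypothesis mf : measurable_fun setT f.

Lemma measurable_sublevel x : measurable (sublevel x).
Proof.
rewrite (_ : sublevel x = `[0, 1] `&` [set s | f s <= cst x s]).
  by apply: measurable_fun_le => //; exact: measurable_funTS.
by apply/seteqP; split => s /=; rewrite in_itv.
Qed.

Lemma sublevelE x : lam (sublevel x) = (value_cdf x)%:E.
Proof.
rewrite fineK// ge0_fin_numE//.
apply: (@le_lt_trans _ _ (lam `[0%R, 1%R])).
  apply: le_measure; rewrite ?inE//; first exact: measurable_sublevel.
  by move=> s [/=]; rewrite in_itv.
by rewrite lebesgue_measure01 ltry.
Qed.

Lemma value_cdf_ge0 x : 0 <= value_cdf x.
Proof. exact: fine_ge0. Qed.

Lemma value_cdf_nondecreasing : {homo value_cdf : x y / x <= y}.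
Proof.
move=> x y xy; rewrite -lee_fin -!sublevelE.
apply: le_measure; rewrite ?inE; [exact: measurable_sublevel..|].
by move=> s [s01 fs]; split=> //; exact: le_trans xy.
Qed.

Lemma value_cdf_top x : (forall t, 0 <= t <= 1 -> f t <= x) -> value_cdf x = 1.
Proof.
move=> fx; apply: EFin_inj; rewrite -sublevelE -lebesgue_measure01.
congr (lam _); apply/seteqP; split => s; rewrite /= in_itv/=; first by case.
by move=> s01; split => //; exact: fx.
Qed.

Lemma value_cdf_bot x : (forall t, 0 <= t <= 1 -> x < f t) -> value_cdf x = 0.
Proof.
move=> xf; apply: EFin_inj; rewrite -sublevelE.
rewrite (_ : sublevel x = set0) ?measure0//.
by apply/seteqP; split => s //= -[/xf]; rewrite ltNge => /negP.
Qed.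

Lemma value_cdf_le1 x : value_cdf x <= 1.
Proof.
rewrite -lee_fin -sublevelE -lebesgue_measure01.
apply: le_measure; rewrite ?inE//; first exact: measurable_sublevel.
by move=> s [/=]; rewrite in_itv.
Qed.

Lemma measurable_value_cdf : measurable_fun setT value_cdf.
Proof.
by apply: nondecreasing_measurable => // x y; exact: value_cdf_nondecreasing.
Qed.

Lemma measurable_gap_set a : measurable (gap_set a).
Proof.
apply: (measurable_fun_le measurable_unit_square).
  by apply: measurable_funTS; exact: measurableT_comp.
apply: measurable_funTS; apply: measurable_funB => //.
exact: measurableT_comp.
Qed.

Lemma measurable_rank_set a : measurable (rank_set a).
Proof.
rewrite (_ : rank_set a = [set p : R * R | 0 <= p.1 <= 1 /\ 0 <= p.2 <= 1] `&`
  (fun p : R * R => p.1 + a < value_cdf (f p.2)) @^-1` [set true]); last by [].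
apply: (measurable_fun_ltr _ _ measurable_unit_square) => //.
  by apply: measurable_funTS; apply: measurable_funD.
apply: measurable_funTS; apply: measurableT_comp; first exact: measurable_value_cdf.
exact: measurableT_comp.
Qed.

Hypothesis value_cdf_lipschitz :
  forall x y, x <= y -> value_cdf y - value_cdf x <= y - x.

(** The probability integral transform: a random variable composed with its
    own continuous distribution function is uniform on the unit interval.  The
    event that [value_cdf (f t) <= w] is the event [f t <= x] for the largest
    [x] at which the distribution function is at most [w]; by continuity it
    equals [w] there. *)
Lemma value_cdf_uniform M w :
  (forall t, 0 <= t <= 1 -> `|f t| <= M) -> 0 <= w ->
  lam [set t | 0 <= t <= 1 /\ w < value_cdf (f t)] = (Num.max 0 (1 - w))%:E.
Proof.
move=> fM w0; have [w1|w1] := leP 1 w.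
  rewrite max_l ?subr_le0// (_ : [set _ | _] = set0) ?measure0//.
  apply/seteqP; split => t //= -[_]; rewrite ltNge => /negP; apply.
  exact: le_trans (value_cdf_le1 _) w1.
rewrite max_r ?subr_ge0 ?ltW//.
pose S := [set x | value_cdf x <= w].
have ubS : ubound S M.
  move=> x Sx; rewrite leNgt; apply/negP => Mx.
  move: Sx; rewrite /S/= value_cdf_top; first by rewrite leNgt w1.
  by move=> t /fM; rewrite ler_norml; lra.
have SM : S (- M - 1).
  by rewrite /S/= value_cdf_bot// => t /fM; rewrite ler_norml; lra.
have supS : has_sup S by split; [exists (- M - 1)|exists M].
pose x := sup S.
have xE : value_cdf x = w.
  apply/eqP; rewrite eq_le; apply/andP; split.
    (* x is a limit of points where the distribution function is at most w *)
    apply/ler_addgt0Pr => e e0.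
    have [y Sy xey] := sup_adherent e0 supS.
    have yx : y <= x by apply: sup_upper_bound.
    have := value_cdf_lipschitz yx; move: Sy xey; rewrite /S/= -/x; lra.
  (* just to the right of x the distribution function exceeds w *)
  apply/ler_addgt0Pr => e e0.
  have xxe : x <= x + e by lra.
  have := value_cdf_lipschitz xxe.
  suff : w < value_cdf (x + e) by lra.
  rewrite ltNge; apply/negP => Sxe.
  by have := sup_upper_bound supS Sxe; rewrite -/x; lra.
rewrite (_ : [set _ | _] = `[0, 1]%classic `\` sublevel x); last first.
  apply/seteqP; split => t /=; rewrite in_itv/=.
    move=> [t01 wt]; split => //; rewrite /sublevel/= => -[_ ftx].
    by move: wt; rewrite -xE ltNge value_cdf_nondecreasing.
  move=> [t01 nt]; split=> //; rewrite ltNge; apply/negP => Sft; apply: nt.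
  by split=> //; exact: sup_upper_bound.
have sub01 : sublevel x `<=` `[0, 1]%classic.
  by move=> s [/=]; rewrite in_itv.
rewrite measureD//=; [|exact: measurable_sublevel|].
  rewrite (setIidr sub01) lebesgue_measure01.
  by rewrite sublevelE xE.
by rewrite lebesgue_measure01 ltry.
Qed.

(** By uniformity of [value_cdf \o f], these slices, and with them the measure
    of [rank_set f a], do not depend on [f]. *)
Lemma xsection_rank_set M a u :
  (forall t, 0 <= t <= 1 -> `|f t| <= M) -> 0 <= a ->
  lam (xsection (rank_set a) u) =
  if 0 <= u <= 1 then (Num.max 0 (1 - (u + a)))%:E else 0%E.
Proof.
move=> fM a0; case: ifPn => [u01|u01].
  rewrite -(value_cdf_uniform fM); last by move: u01; lra.
  congr (lam _); apply/seteqP; split => t /=.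
    by move/xsectionP => -[[]].
  by move=> [t01 ut]; apply/xsectionP.
rewrite (_ : xsection _ _ = set0) ?measure0//.
apply/seteqP; split => t //= /xsectionP[[/= u01' _] _].
by rewrite u01' in u01.
Qed.

Lemma ysection_rank_set a t : 0 <= a ->
  lam (ysection (rank_set a) t) =
  if 0 <= t <= 1 then (Num.max 0 (value_cdf (f t) - a))%:E else 0%E.
Proof.
move=> a0; case: ifPn => [t01|t01]; last first.
  rewrite (_ : ysection _ _ = set0) ?measure0//.
  apply/seteqP; split => u //= /ysectionP[[/= _ t01'] _].
  by rewrite t01' in t01.
rewrite (_ : ysection _ _ = `[0, value_cdf (f t) - a[%classic).
  rewrite lebesgue_measure_itv/= lte_fin.
  by case: ltP => // _; rewrite oppr0 adde0.
apply/seteqP; split => u /=; rewrite in_itv/=.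
  by move/ysectionP => -[[/= u01 _]]; move: u01; lra.
move=> uv; apply/ysectionP; split => /=; last by move: uv; lra.
by split => //; have := value_cdf_le1 (f t); move: uv a0; lra.
Qed.

Lemma ysection_gap_set a t :
  lam (ysection (gap_set a) t) =
  if 0 <= t <= 1 then (value_cdf (f t - a))%:E else 0%E.
Proof.
case: ifPn => [t01|t01]; last first.
  rewrite (_ : ysection _ _ = set0) ?measure0//.
  apply/seteqP; split => u //= /ysectionP[[/= _ t01'] _].
  by rewrite t01' in t01.
rewrite -sublevelE; congr (lam _); apply/seteqP; split => s.
  by move/ysectionP => -[[]].
by move=> [s01 fs]; apply/ysectionP.
Qed.

(** Passing from [f] to [value_cdf \o f] brings values closer together, since
    the distribution function is 1-Lipschitz.  In terms of slices at [t]: the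
    probability of [f s <= f t - a] is [value_cdf (f t - a)], which is at least
    the positive part of [value_cdf (f t) - a]. *)
Lemma rank_set_le_gap_set a : 0 <= a ->
  ((lam \x lam) (rank_set a) <= (lam \x lam) (gap_set a))%E.
Proof.
move=> a0; apply: le_product_measure_ysection => [||t].
- exact: measurable_gap_set.
- exact: measurable_rank_set.
rewrite ysection_rank_set// ysection_gap_set; case: ifP => // _.
rewrite lee_fin ge_max value_cdf_ge0/=.
have /value_cdf_lipschitz : f t - a <= f t by lra.
by lra.
Qed.

(** If the values of [f] lie in an interval of length 1, a 1-Lipschitz
    distribution function has to climb from 0 to 1 at full speed: it is
    [x - m] on that interval, hence preserves distances, and nothing is lost
    in the comparison of slices. *)
Lemma rank_set_eq_gap_set a m : 0 <= a ->
  (forall t, 0 <= t <= 1 -> m <= f t <= m + 1) ->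
  (lam \x lam)%E (rank_set a) = (lam \x lam)%E (gap_set a).
Proof.
move=> a0 fm; apply: eq_product_measure_ysection => [||t].
- exact: measurable_gap_set.
- exact: measurable_rank_set.
rewrite ysection_rank_set// ysection_gap_set; case: ifP => // /fm ftm.
congr EFin.
have cdf_bot x : x < m -> value_cdf x = 0.
  by move=> xm; apply: value_cdf_bot => s /fm; lra.
have cdf_top : value_cdf (m + 1) = 1 by apply: value_cdf_top => s /fm; lra.
have cdfE x : m <= x <= m + 1 -> value_cdf x = x - m.
  move=> /andP[mx xm]; apply/eqP; rewrite eq_le; apply/andP; split.
    apply/ler_addgt0Pr => e e0.
    have mex : m - e <= x by lra.
    by have := value_cdf_lipschitz mex; rewrite (cdf_bot (m - e)); lra.
  by have := value_cdf_lipschitz xm; rewrite cdf_top; lra.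
rewrite (cdfE (f t))//; have [ftam|ftam] := ltP (f t - a) m.
  by rewrite cdf_bot// max_l//; lra.
by rewrite cdfE ?max_r; lra.
Qed.

(** The event that the values differ by less than [a] is the unit square minus
    [gap_set f a] and its mirror image, which are disjoint for [a > 0]. *)
Lemma distr_gap_set a : 0 < a ->
  ((lam \x lam) [set p : R * R |
       [/\ 0 <= p.1 <= 1, 0 <= p.2 <= 1 & `|f p.2 - f p.1| < a]%R]
  + (lam \x lam) (gap_set a) *+ 2 = 1)%E.
Proof.
move=> a0; set Q := [set _ | _].
pose swap_gap := [set p : R * R |
  (0 <= p.1 <= 1 /\ 0 <= p.2 <= 1) /\ f p.2 <= f p.1 - a].
have mf1 : measurable_fun setT (fun p : R * R => f p.1) by exact: measurableT_comp.
have mf2 : measurable_fun setT (fun p : R * R => f p.2) by exact: measurableT_comp.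
have mgap := measurable_gap_set a.
have mswap : measurable swap_gap.
  apply: (measurable_fun_le measurable_unit_square); apply: measurable_funTS => //.
  exact: measurable_funB.
have swapE : (lam \x lam)%E swap_gap = (lam \x lam)%E (gap_set a).
  rewrite (product_measure_ysection mgap); apply: eq_integral => x _ /=.
  congr (lam _); apply/seteqP; split => y.
    by move/xsectionP => -[/= [? ?] ?]; apply/ysectionP.
  by move/ysectionP => -[/= [? ?] ?]; apply/xsectionP.
have QE : Q = [set p : R * R | 0 <= p.1 <= 1 /\ 0 <= p.2 <= 1] `\`
    (swap_gap `|` gap_set a).
  apply/seteqP; split => -[s t]; rewrite /Q /swap_gap /gap_set/= ltr_norml.
    by move=> [s01 t01 st]; split=> // -[[_]|[_]]; lra.
  move=> [[s01 t01] nst]; split=> //; apply/andP; split.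
    by rewrite ltNge; apply/negP => h; apply: nst; left; split=> //; lra.
  by rewrite ltNge; apply/negP => h; apply: nst; right; split=> //; lra.
have gap_sq : swap_gap `|` gap_set a `<=`
    [set p : R * R | 0 <= p.1 <= 1 /\ 0 <= p.2 <= 1].
  by move=> p [] [].
have mU : measurable (swap_gap `|` gap_set a) by exact: measurableU.
have mQ : measurable Q.
  by rewrite QE; apply: measurableD => //; exact: measurable_unit_square.
rewrite mule2n -[X in (_ + (X + _))%E]swapE.
rewrite -(measureU (lam \x lam)%E mswap mgap); last first.
  apply/seteqP; split => // -[s t] [[_ /= st] [_ /= ts]].
  by move: st ts; lra.
rewrite -(measureU (lam \x lam)%E mQ mU); last by rewrite QE setDKI.
by rewrite QE setUC setDUK//; exact: lebesgue_measure_unit_square.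
Qed.

End uniform_rank.

(** * The distribution function of the discrepancy *)

Section discrepancy.
Variables (R : realType) (P : {fset R}).
Local Notation lam := (@lebesgue_measure R).

Definition count_below (t : R) : nat := count (fun x => x < t) (enum_fset P).

Lemma count_below_le t : (count_below t <= #|` P|%fset)%N.
Proof. exact: count_size. Qed.

Lemma count_below_nondecreasing s t : s <= t ->
  (count_below s <= count_below t)%N.
Proof. by move=> st; apply: sub_count => x /= /lt_le_trans; apply. Qed.

(** The half-open counting intervals do not count the point [s] at [s] but do
    count it at any later time: this is the unit jump of the discrepancy to
    the right of a point of [P]. *)
Lemma count_below_jump s t : s < t ->
  (count_below s + (s \in P) <= count_below t)%N.
Proof.
move=> st; have -> : (s \in P : nat) = count_mem s (enum_fset P).
  by rewrite count_uniq_mem ?fset_uniq.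
rewrite -count_predUI (_ : count (predI _ _) _ = 0%N) ?addn0.
  by apply: sub_count => x /= /orP[/lt_trans|/eqP->//]; apply.
by apply/eqP; rewrite -leqn0 leqNgt -has_count; apply/hasPn => x _ /=;
  case: ltgtP.
Qed.

Lemma measurable_discr : measurable_fun setT (discr P).
Proof.
rewrite (_ : discr P = fun t => \sum_(x <- enum_fset P)
    (0 <= x)%R%:R * \1_(`]x, +oo[%classic) t - #|` P|%fset%:R * t); last first.
  apply/funext => t; rewrite /discr; congr (_ - _); apply: eq_bigr => x _.
  rewrite !indicE !mem_setE !in_itv/= andbT.
  by case: (0 <= x); rewrite ?mul1r ?mul0r.
apply: measurable_funB; last exact: measurable_funM.
by apply: measurable_sum => x; apply: measurable_funM => //; exact: measurable_indic.
Qed.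

Hypothesis P01 : forall x, x \in P -> 0 <= x <= 1.

Lemma discrE t : discr P t = (count_below t)%:R - #|` P|%fset%:R * t.
Proof.
rewrite /discr; congr (_ - _); rewrite /count_below -sum1_count natr_sum.
rewrite [RHS]big_mkcond/= !big_seq; apply: eq_bigr => x xP.
rewrite indicE mem_setE in_itv/=.
have /andP[-> _] := P01 xP.
by case: ltP.
Qed.

Lemma discr_bounded t : 0 <= t <= 1 -> `|discr P t| <= #|` P|%fset%:R.
Proof.
move=> t01; rewrite discrE ler_norml.
have : (count_below t)%:R <= #|` P|%fset%:R :> R by rewrite ler_nat count_below_le.
have : 0 <= (count_below t)%:R :> R by [].
have : 0 <= #|` P|%fset%:R :> R by [].
nra.
Qed.

(** The discrepancy is an integer minus [N * t], so [x < discr P t <= y]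
    puts [t] in an interval from [(c - y) / N] to [(c - x) / N] with [c] an
    integer.  When [x] and [y] lie between the consecutive integers [k - 1] and
    [k], only the [N] intervals with [c = k, ..., k + N - 1] can contain a [t]
    with [0 <= t < 1], and their lengths add up to [y - x]. *)
Lemma lebesgue_measure_discr_level (k : int) x y : (0 < #|` P|%fset)%N ->
  k%:~R - 1 <= x -> x <= y -> y <= k%:~R ->
  (lam (sublevel (discr P) y `\` sublevel (discr P) x) <= (y - x)%:E)%E.
Proof.
move=> P0; set N := #|` P|%fset in P0 * => kx xy yk.
have N0 : 0 < N%:R :> R by rewrite ltr0n.
(* the additional set A N takes care of the endpoint t = 1, where c = k + N is
   possible *)
pose A j : set R := if (j < N)%N then
  `[(k%:~R + j%:R - y) / N%:R, (k%:~R + j%:R - x) / N%:R[%classic else [set 1].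
have mA j : measurable (A j) by rewrite /A; case: ifP.
have mL : measurable (sublevel (discr P) y `\` sublevel (discr P) x).
  by apply: measurableD; apply: measurable_sublevel; exact: measurable_discr.
have cover : sublevel (discr P) y `\` sublevel (discr P) x `<=`
    \big[setU/set0]_(j < N.+1) A j.
  move=> t [[t01 ty] nxt]; rewrite -bigcup_mkord.
  have {nxt}xt : x < discr P t by rewrite ltNge; apply/negP => tx; exact: nxt.
  have [->|t1] := eqVneq t 1; first by exists N; rewrite //= /A ltnn.
  have {}t01 : 0 <= t < 1 by rewrite lt_neqAle t1.
  move: xt ty; rewrite discrE -/N; set c := count_below t => xt ty.
  have Nt : 0 <= N%:R * t < N%:R by nra.
  have kc : k <= c%:Z.
    by rewrite -ltzD1 -(ltr_int R) intrD -[c%:~R]/(c%:R : R); lra.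
  have ck : c%:Z < k + N%:Z.
    by rewrite -(ltr_int R) intrD -[c%:~R]/(c%:R : R) -[N%:~R]/(N%:R : R); lra.
  have [j jE] : exists j : nat, c%:Z = k + j%:Z.
    by exists `|c%:Z - k|%N; lia.
  have jN : (j < N)%N by lia.
  have cE : c%:R = k%:~R + j%:R :> R by rewrite -[c%:R]/(c%:~R : R) jE intrD.
  exists j; first by rewrite /= ltnW.
  rewrite /A jN /= in_itv/= ler_pdivrMr// ltr_pdivlMr//.
  by move: xt ty; rewrite cE; lra.
apply: le_trans (content_subadditive lam (fun j _ => mA j) mL cover) _.
rewrite big_ord_recr/= {2}/A ltnn lebesgue_measure_set1 adde0.
rewrite (eq_bigr (fun=> ((y - x) / N%:R)%:E)); last first.
  move=> j _; rewrite /A ltn_ord lebesgue_measure_itv/= lte_fin.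
  case: ltP => h.
    by rewrite -EFinB; congr EFin; rewrite -mulrBl; congr (_ * _); lra.
  congr EFin; move: h; rewrite ler_pM2r ?invr_gt0// => h.
  by rewrite (_ : y - x = 0) ?mul0r//; lra.
rewrite sumEFin lee_fin sumr_const card_ord -[leLHS]mulr_natr divfK//.
exact: lt0r_neq0.
Qed.

(** Levels at distance less than 1 are separated by at most one integer, where
    the interval between them can be cut; for levels further apart it is
    enough that a distribution function increases by at most 1. *)
Lemma value_cdf_discr_lipschitz : (0 < #|` P|%fset)%N -> forall x y, x <= y ->
  value_cdf (discr P) y - value_cdf (discr P) x <= y - x.
Proof.
move=> P0.
have cell (k : int) x y : k%:~R - 1 <= x -> x <= y -> y <= k%:~R ->
    value_cdf (discr P) y - value_cdf (discr P) x <= y - x.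
  move=> kx xy yk; rewrite lerBlDl -lee_fin EFinD.
  rewrite -!(sublevelE measurable_discr).
  apply: le_trans (leeD (le_refl _) (lebesgue_measure_discr_level P0 kx xy yk)).
  have subxy : sublevel (discr P) x `<=` sublevel (discr P) y.
    by move=> t [t01 tx]; split=> //; exact: le_trans xy.
  rewrite -[in leLHS](setDUK subxy); apply: measureU2 => //.
    by apply: measurable_sublevel; exact: measurable_discr.
  by apply: measurableD; apply: measurable_sublevel; exact: measurable_discr.
move=> x y xy.
have [yx1|yx1] := leP 1 (y - x).
  apply: le_trans yx1; rewrite lerBlDr.
  apply: le_trans (value_cdf_le1 measurable_discr y) _.
  by rewrite lerDl value_cdf_ge0.
pose k := Num.floor x + 1.
have kx : k%:~R - 1 <= x by rewrite intrD addrK; exact: floor_le.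
have xk : x < k%:~R by exact: floorD1_gt.
have [yk|ky] := leP y k%:~R; first exact: (cell k).
have := cell k x k%:~R kx (ltW xk) (lexx _).
have := cell (k + 1) k%:~R y; rewrite intrD addrK => /(_ (lexx _) (ltW ky)).
have : y <= k%:~R + 1 by lra.
by move=> yk1 /(_ yk1); lra.
Qed.

End discrepancy.

(** * Oscillation at most one and regular grids *)

Section gap_of_discrepancy.
Variables (R : realType).
Local Notation lam := (@lebesgue_measure R).
Implicit Types P Q : {fset R}.

Lemma rank_set_discr_eq P Q a : 0 <= a ->
  (0 < #|` P|%fset)%N -> (forall x, x \in P -> 0 <= x <= 1) ->
  (0 < #|` Q|%fset)%N -> (forall x, x \in Q -> 0 <= x <= 1) ->
  (lam \x lam)%E (rank_set (discr P) a) = (lam \x lam)%E (rank_set (discr Q) a).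
Proof.
move=> a0 P0 P01 Q0 Q01; apply: eq_product_measure_xsection => u.
rewrite (xsection_rank_set (measurable_discr Q)
  (value_cdf_discr_lipschitz Q01 Q0) u (discr_bounded Q01) a0).
by rewrite (xsection_rank_set (measurable_discr P)
  (value_cdf_discr_lipschitz P01 P0) u (discr_bounded P01) a0).
Qed.

Lemma discr2_distrE P a : 0 < a ->
  exists2 g : R, (lam \x lam)%E (gap_set (discr P) a) = g%:E &
    discr2_distr P a = (1 - g *+ 2)%:E.
Proof.
move=> a0; have := distr_gap_set (measurable_discr P) a0.
rewrite -[X in (X + _)%E]/(discr2_distr P a).
have : (0 <= discr2_distr P a)%E by exact: measure_ge0.
have : (0 <= (lam \x lam) (gap_set (discr P) a))%E by exact: measure_ge0.
case: ((lam \x lam)%E _) => [g||]//; case: (discr2_distr P a) => [x||]// _ _.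
rewrite -EFin_natmul -EFinD => -[<-]; exists g => //; congr EFin; lra.
Qed.

(** The left-hand side is the right limit of the discrepancy at [t], and the
    discrepancy is left-continuous at [s].  So a violation would persist, by
    the slope [-N], on a small rectangle to the left of [s] and to the right of
    [t], of positive measure. *)
Lemma discr_jump_le1 P : (0 < #|` P|%fset)%N ->
  (forall x, x \in P -> 0 <= x <= 1) ->
  (lam \x lam)%E (gap_set (discr P) 1) = 0%E ->
  forall s t, 0 < s <= 1 -> 0 <= t < 1 ->
  discr P t + (t \in P)%:R <= discr P s + 1.
Proof.
move=> P0 P01 gap0 s t s01 t01; rewrite leNgt; apply/negP => st.
set N := #|` P|%fset in P0; have N0 : 0 < N%:R :> R by rewrite ltr0n.
(* moving s and t by less than e costs at most 2 * N * e of the excess D *)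
pose D := discr P t + (t \in P)%:R - discr P s - 1.
pose e := Num.min (Num.min s (1 - t)) (D / (2 * N%:R)).
have e0 : 0 < e.
  by rewrite !lt_min divr_gt0 ?mulr_gt0//; move: st s01 t01; rewrite /D; lra.
have es : e <= s by rewrite /e !ge_min lexx.
have et : e <= 1 - t by rewrite /e !ge_min lexx orbT.
have eD : 2 * (N%:R * e) <= D.
  by rewrite mulrA mulrC -ler_pdivlMr ?mulr_gt0// /e ge_min lexx orbT.
suff : (0 < (lam \x lam) (gap_set (discr P) 1))%E by rewrite gap0 ltxx.
pose U : set R := `]s - e, s[%classic; pose V : set R := `]t, t + e[%classic.
have mU : measurable U by exact: measurable_itv.
have mV : measurable V by exact: measurable_itv.
have box : U `*` V `<=` gap_set (discr P) 1.
  move=> [u v] [/=]; rewrite /U /V/= !in_itv/= => us vt; split => /=.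
    by split; lra.
  rewrite !(discrE P01) -/N.
  have /(count_below_nondecreasing P) : u <= s by lra.
  have /(count_below_jump P) : t < v by lra.
  rewrite -!(ler_nat R) natrD.
  move: eD; rewrite /D !(discrE P01) -/N.
  have : N%:R * v <= N%:R * (t + e) by rewrite ler_pM2l//; lra.
  have : N%:R * (s - e) <= N%:R * u by rewrite ler_pM2l//; lra.
  by rewrite !mulrDr mulrN; lra.
have : ((lam \x lam) (U `*` V) <= (lam \x lam) (gap_set (discr P) 1))%E.
  apply: le_measure => //; rewrite inE; first exact: measurableX.
  by apply: measurable_gap_set; exact: measurable_discr.
apply: lt_le_trans; rewrite product_measure1E//= /U /V !lebesgue_measure_itv/= !lte_fin.
have -> : s - e < s by lra.
have -> : t < t + e by lra.
by rewrite -!EFinB -EFinM lte_fin; apply: mulr_gt0; lra.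
Qed.

(** Every point of [P] is followed by a jump from its value to that value plus
    1, so when the oscillation is at most 1 the discrepancy takes its infimum,
    one common value [D], at all points of [P].  Solving
    [count_below P x - N * x = D] for [x] puts [P] inside the grid shifted by
    [- D / N], and both sets have [N] elements.  The endpoints 0 (no value to
    the left) and 1 (no jump to the right) are settled by the explicit values
    of the discrepancy there; the shift [1 / N] occurs when [1 \in P]. *)
Lemma fset_eq_shifted_grid P : (0 < #|` P|%fset)%N ->
  (forall x, x \in P -> 0 <= x <= 1) ->
  (forall s t, 0 < s <= 1 -> 0 <= t < 1 ->
    discr P t + (t \in P)%:R <= discr P s + 1) ->
  exists2 d, 0 <= d <= (#|` P|%fset)%:R^-1 & P = shifted_grid #|` P|%fset d.
Proof.
move=> P0 P01 jump; set N := #|` P|%fset in P0 *.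
have N0 : 0 < N%:R :> R by rewrite ltr0n.
have D0 : discr P 0 = 0.
  rewrite (discrE P01) mulr0 subr0 /count_below; apply/eqP.
  rewrite pnatr_eq0 -leqn0 leqNgt -has_count; apply/hasPn => x xP /=.
  by rewrite -leNgt; have /andP[] := P01 _ xP.
have D1 : discr P 1 <= - (1 \in P)%:R.
  rewrite (discrE P01) mulr1 -/N.
  suff : (count_below P 1 + (1%R \in P) <= N)%N.
    by rewrite -(ler_nat R) natrD; lra.
  apply: leq_trans (count_below_jump P (_ : (1 : R) < 2)) (count_below_le _ _).
  by rewrite ltr1n.
have discr_le1 x : x \in P -> discr P x <= 0.
  move=> xP; have x01 := P01 _ xP.
  have [x1|x1] := eqVneq x 1; first by move: D1; rewrite -x1 xP/=; lra.
  have := jump 1 x; rewrite xP lexx ltr01 lt_neqAle x1 => /(_ erefl x01).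
  by move: D1; case: (1 \in P) => /=; lra.
have discr_geN1 x : x \in P -> - 1 <= discr P x.
  move=> xP; have x01 := P01 _ xP.
  have [->|x0] := eqVneq x 0; first by rewrite D0; lra.
  have := jump x 0; rewrite lt_neqAle eq_sym x0 D0 lexx ltr01.
  move=> /(_ x01 erefl); have : 0 <= (0 \in P)%:R :> R by [].
  by lra.
have discr_le x y : x \in P -> y \in P -> discr P x <= discr P y.
  move=> xP yP; have x01 := P01 _ xP; have y01 := P01 _ yP.
  have [y0|y0] := eqVneq y 0; first by rewrite y0 D0; exact: discr_le1.
  have [x1|x1] := eqVneq x 1.
    have : discr P x <= -1 by move: D1; rewrite -x1 xP.
    by have := discr_geN1 _ yP; lra.
  have := jump y x; rewrite xP lt_neqAle eq_sym y0 y01 lt_neqAle x1.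
  by move=> /(_ erefl x01); rewrite lerD2r.
have [x0 x0P] : exists x, x \in P by apply/fset0Pn; rewrite -cardfs_gt0.
exists (- discr P x0 / N%:R).
  apply/andP; split.
    by apply: divr_ge0; [rewrite oppr_ge0; exact: discr_le1|exact: ltW].
  rewrite ler_pdivrMr// mulVf ?gt_eqF//.
  by have := discr_geN1 _ x0P; lra.
apply/eqP; rewrite eqEfcard card_shifted_grid leqnn andbT.
apply/fsubsetP => x xP; apply/imfsetP; exists (count_below P x) => /=.
  rewrite mem_iota add0n leq0n/= -/N.
  have := count_below_jump P (_ : x < x + 1); rewrite xP addn1 => /(_ _)/leq_trans.
  by apply; [rewrite ltrDl|exact: count_below_le].
have : discr P x = discr P x0 by apply/eqP; rewrite eq_le !discr_le.
rewrite (discrE P01 x) -/N => <-; field.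
exact: lt0r_neq0.
Qed.

Lemma shifted_grid01 N (d x : R) : 0 <= d <= N%:R^-1 ->
  x \in shifted_grid N d -> 0 <= x <= 1.
Proof.
move=> d01 /imfsetP[n/=]; rewrite mem_iota add0n => /= nN ->.
have N0 : 0 < N%:R :> R by rewrite ltr0n; apply: leq_ltn_trans nN.
have n0 : 0 <= n%:R / N%:R :> R by rewrite divr_ge0.
have : n%:R / N%:R + N%:R^-1 <= 1 :> R.
  by rewrite -[X in _ + X]mul1r -mulrDl ler_pdivrMr// mul1r natr1 ler_nat.
by lra.
Qed.

(** The number of naturals below [y] is the ceiling of [y], as long as this lies
    between 0 and [N]. *)
Lemma sum_lt_bounds N (y : R) : -1 <= y <= N%:R ->
  y <= \sum_(0 <= n < N) (n%:R < y)%R%:R <= y + 1.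
Proof.
elim: N y => [|N IH] y yN; first by rewrite big_geq//; lra.
rewrite big_nat_recr//=; have [Ny|yN'] := ltP N%:R y.
  rewrite (@eq_big_nat _ _ _ _ _ _ (fun=> 1)).
    by rewrite sumr_const_nat subn0 natr1; move: yN; rewrite -natr1; lra.
  move=> n /= nN; rewrite (lt_trans _ Ny)// ltr_nat//.
by rewrite addr0; apply: IH; lra.
Qed.

(** The discrepancy of a shifted grid is a sawtooth of height exactly 1: its
    jumps occur whenever it has fallen to [- (N * d)]. *)
Lemma discr_shifted_grid N (d t : R) : (0 < N)%N -> 0 <= d <= N%:R^-1 ->
  0 <= t <= 1 ->
  - (N%:R * d) <= discr (shifted_grid N d) t <= - (N%:R * d) + 1.
Proof.
move=> N_gt0 dN t01; have N0 : 0 < N%:R :> R by rewrite ltr0n.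
have Nd : N%:R * d <= 1.
  by rewrite mulrC -ler_pdivlMr// div1r; case/andP: dN.
rewrite (discrE (fun x => @shifted_grid01 N d x dN)) card_shifted_grid.
have cE : (count_below (shifted_grid N d) t)%:R =
    \sum_(0 <= n < N) (n%:R < N%:R * (t - d))%R%:R :> R.
  rewrite /count_below -sum1_count natr_sum big_mkcond/=.
  rewrite (big_imfset _ _ _ (h := fun n => n%:R / N%:R + d))/=; last first.
    move=> m n _ _ /addIr/mulIf; rewrite invr_eq0 pnatr_eq0 -lt0n => /(_ N_gt0)/eqP.
    by rewrite eqr_nat => /eqP.
  rewrite undup_id ?iota_uniq// /index_iota subn0; apply: eq_bigr => n _.
  rewrite [N%:R * _]mulrC -ltr_pdivrMr// ltrBrDr.
  by case: (_ < _).
rewrite cE; have : -1 <= N%:R * (t - d) <= N%:R.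
  have : 0 <= N%:R * t <= N%:R * 1 by rewrite mulr_ge0 ?ler_pM2l//; case/andP: t01.
  have : 0 <= N%:R * d by rewrite mulr_ge0//; case/andP: dN.
  by rewrite mulrBr; lra.
by move/sum_lt_bounds; rewrite mulrBr; lra.
Qed.

End gap_of_discrepancy.

(** * Extremality of the centered regular grid *)

Theorem theorem4p1 (R : realType) (N : nat) (P : {fset R}) :
  (0 < N)%N ->
  #|` P|%fset = N ->
  (forall x : R, x \in P -> 0 <= x <= 1) ->
  (forall a : R, 0 < a ->
     (discr2_distr P a <= discr2_distr (centered_grid R N) a)%E)
  /\
  ((forall a : R, 0 < a ->
      discr2_distr P a = discr2_distr (centered_grid R N) a)
   <->
   (exists d : R, 0 <= d < N%:R^-1 /\ P = shifted_grid N d)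
   \/ P = shifted_grid N N%:R^-1).
Proof.
move=> N0 PN P01; have NR : 0 < N%:R :> R by rewrite ltr0n.
have P0 : (0 < #|` P|%fset)%N by rewrite PN.
have grid_gap d a : 0 <= d <= N%:R^-1 -> 0 < a ->
    (@lebesgue_measure R \x @lebesgue_measure R)%E
      (gap_set (discr (shifted_grid N d)) a) =
    (@lebesgue_measure R \x @lebesgue_measure R)%E (rank_set (discr P) a).
  move=> dN a0; have G01 := @shifted_grid01 _ N d ^~ dN.
  have G0 : (0 < #|` shifted_grid N d|%fset)%N by rewrite card_shifted_grid.
  rewrite -(rank_set_eq_gap_set (measurable_discr _)
    (value_cdf_discr_lipschitz G01 G0) (ltW a0)
    (fun t => @discr_shifted_grid R N d t N0 dN)).
  exact: rank_set_discr_eq (ltW a0) _ _ _ _.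
have center_dN : 0 <= ((2 * N)%N%:R^-1 : R) <= N%:R^-1.
  by rewrite invr_ge0 ler0n lef_pV2 ?posrE ?ltr0n ?muln_gt0 ?N0// ler_nat leq_pmull.
have distr_grid d a : 0 <= d <= N%:R^-1 -> 0 < a ->
    discr2_distr (shifted_grid N d) a = discr2_distr (centered_grid R N) a.
  move=> dN a0; rewrite -shifted_grid_centered.
  have [g gE ->] := discr2_distrE (shifted_grid N d) a0.
  have [h hE ->] := discr2_distrE (shifted_grid N (2 * N)%N%:R^-1) a0.
  by move: gE hE; rewrite !grid_gap// => -> [->].
split=> [a a0|].
  rewrite -shifted_grid_centered.
  have [g gE ->] := discr2_distrE P a0.
  have [h hE ->] := discr2_distrE (shifted_grid N (2 * N)%N%:R^-1) a0.
  have := rank_set_le_gap_set (measurable_discr P)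
    (value_cdf_discr_lipschitz P01 P0) (ltW a0).
  by rewrite gE -(grid_gap _ _ center_dN a0) hE !lee_fin; lra.
split=> [eqP|]; last first.
  case=> [[d [/andP[d0 dN] ->]]|->] a a0; apply: distr_grid => //.
    by rewrite d0 ltW.
  by rewrite invr_ge0 ler0n lexx.
(* equality at a = 1 alone is enough: there the common value of the two gaps is
   0, as distribution functions never exceed 1 *)
have gap0 : (@lebesgue_measure R \x @lebesgue_measure R)%E
    (gap_set (discr P) 1) = 0%E.
  have := eqP 1 ltr01; rewrite -shifted_grid_centered.
  have [g gE ->] := discr2_distrE P (@ltr01 R).
  have [h hE ->] := discr2_distrE (shifted_grid N (2 * N)%N%:R^-1) (@ltr01 R).
  move=> [gh]; rewrite gE; have -> : g = h by lra.
  rewrite -hE grid_gap// (_ : rank_set _ 1 = set0) ?measure0//.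
  apply/seteqP; split => -[u t] //= -[/= [u01 _]].
  have := value_cdf_le1 (measurable_discr P) (discr P t).
  by move: u01; lra.
have [d] := fset_eq_shifted_grid P0 P01 (discr_jump_le1 P0 P01 gap0).
rewrite PN => /andP[d0]; rewrite le_eqVlt => /predU1P[->|dN] ->; first by right.
by left; exists d; rewrite d0 dN.
Qed.
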